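(* Let $a, b$ be positive integers and let $l$ be the integer with $0 \le l < b$ and $a \equiv l \pmod b$. Then $D_2(a;b)$ is given by the following formulae. \begin{itemize} \item If $l = 0$ or $l=1$: $D_2(a;b) = 0$. \item If $l = 2$: $D_2(a;b) = \lfloor b/2 \rfloor^2$. \item If $l = 3$: $D_2(a;b) = 5\lfloor b/3\rfloor^2$ when $b \equiv 0, 1 \pmod 3$; and $D_2(a;b) = 5\lfloor b/3\rfloor^2 + 4\lfloor b/3\rfloor + 1$ when $b \equiv 2 \pmod 3$. \item If $l = 4$: $D_2(a;b) = 14\lfloor b/4\rfloor^2$ when $b \equiv 0,1 \pmod 4$; $D_2(a;b) = 14\lfloor b/4\rfloor^2 + 10\lfloor b/4\rfloor + 2$ when $b\equiv 2 \pmod 4$; and $D_2(a;b) = 14\lfloor b/4\rfloor^2 + 16\lfloor b/4\rfloor + 5$ when $b \equiv 3 \pmod 4$. \item If $l = 5$: $D_2(a;b) = 30\lfloor b/5\rfloor^2$ when $b\equiv 0,1 \pmod 5$; $D_2(a;b) = 30\lfloor b/5\rfloor^2 + 14\lfloor b/5\rfloor + 2$ when $b\equiv 2\pmod 5$; $D_2(a;b) = 30\lfloor b/5\rfloor^2 + 26\lfloor b/5\rfloor + 6$ when $b\equiv 3\pmod 5$; and $D_2(a;b) = 30\lfloor b/5\rfloor^2 + 40\lfloor b/5\rfloor + 14$ when $b\equiv 4\pmod 5$. \end{itemize}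
   Context: For positive integers $a,b$ and $0 \le j \le b-1$, let $f_{a;b}(j)$ denote the number of integers $m$ with $\frac{ja}{b} \le m < \frac{(j+1)a}{b}$ (the interval $[0,a)$ is divided into $b$ equal half-open subintervals). Put $I_{a;b}(j) = f_{a;b}(j) - \lfloor a/b \rfloor$ and $D_2(a;b) = \sum_{j=1}^{b-1} j^2\, I_{a;b}(j)$. Here $\lfloor x \rfloor$ is the greatest integer not exceeding $x$. *)

(* Defs.v *)
From mathcomp Require Import all_boot all_order all_algebra.

Set Implicit Arguments.
Unset Strict Implicit.
Unset Printing Implicit Defensive.

Import Order.TTheory GRing.Theory Num.Theory.
Local Open Scope ring_scope.

(* The integers of [0, a) are represented by 'I_a; by f_ab_integers below this
   misses no integer of the j-th subinterval when j < b. *)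
Definition f_ab (a b j : nat) : nat :=
  #|[set m : 'I_a | (j * a)%N%:Q / b%:Q <= (m : nat)%:Q
                    < (j.+1 * a)%N%:Q / b%:Q]|.

Lemma f_ab_integers (a b j : nat) (m : int) : (0 < b)%N -> (j < b)%N ->
  (j * a)%N%:Q / b%:Q <= m%:Q < (j.+1 * a)%N%:Q / b%:Q ->
  exists i : 'I_a, m = i%:Z.
Proof.
move=> b_gt0 lt_jb /andP[lo hi].
have bQ_gt0 : 0 < b%:Q by rewrite ltr0n.
have: 0 <= m by rewrite -(ler0z rat); apply: le_trans lo; rewrite divr_ge0 ?ler0n.
case: m lo hi => // n _ hi _.
suff lt_na : (n < a)%N by exists (Ordinal lt_na).
rewrite -(ltr_nat rat); apply: lt_le_trans hi _.
by rewrite ler_pdivrMr // -natrM ler_nat mulnC leq_mul2l lt_jb orbT.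
Qed.

(* I and D_2 are taken in int, so that no subtraction is truncated. *)
Definition I_ab (a b j : nat) : int := (f_ab a b j)%:Z - (a %/ b)%N%:Z.

Definition D2 (a b : nat) : int :=
  \sum_(1 <= j < b) j%:Z ^+ 2 * I_ab a b j.

(* Main.v *)
Require Import Defs.
From mathcomp Require Import all_boot all_order all_algebra.
From mathcomp Require Import ring.

(** The idea is to count by the integers instead of by the subintervals.  Write
[a = q * b + l] with [0 <= l < b].  Lengthening every subinterval by the
integer [q] adds exactly [q] integers to each of them, so [I_ab a b j] is the
number of integers in the [j]-th of the [b] equal parts of the interval from
[0] to [l], open at [l] ([I_ab_modn]).  An integer [k < l] lies in exactly one
such part, namely the one of index [floor (k * b / l)].  Summing [j ^ 2] over the
subintervals is therefore summing [floor (k * b / l) ^ 2] over the [l] integers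
[k < l] ([D2_modn]): a sum over [b] terms becomes a sum over [l] terms.

For a given small [l], write [b = l * Q + r]; then
[floor (k * b / l) = k * Q + floor (k * r / l)], so the sum is a quadratic
polynomial in [Q] whose coefficients depend on [r] alone ([D2_divn]).  The
formulae of the theorem are these polynomials. *)

Import Order.TTheory GRing.Theory Num.Theory.
Local Open Scope ring_scope.

Lemma f_ab_nat (a b j : nat) : (0 < b)%N ->
  f_ab a b j = #|[set m : 'I_a | j * a <= m * b < j.+1 * a]%N|.
Proof.
move=> b_gt0; apply: eq_card => m; rewrite !inE.
have bQ_gt0 : 0 < b%:Q by rewrite ltr0n.
by rewrite ler_pdivrMr // ltr_pdivlMr // -!natrM ler_nat ltr_nat.
Qed.

Definition ceil_div (n b : nat) : nat := ((n + b.-1) %/ b)%N.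

(** This adjunction turns the rational bounds of a subinterval into integer ones,
so that its integers can be counted by a subtraction. *)
Lemma ceil_div_le (n m b : nat) : (0 < b)%N ->
  (ceil_div n b <= m)%N = (n <= m * b)%N.
Proof.
case: b => // b _; rewrite /ceil_div /= -ltnS ltn_divLR //.
by rewrite mulSn addnC addSn ltnS leq_add2l.
Qed.

Lemma ceil_divMDl (q n b : nat) : (0 < b)%N ->
  ceil_div (q * b + n) b = (q + ceil_div n b)%N.
Proof. by move=> b_gt0; rewrite /ceil_div -addnA divnMDl. Qed.

Lemma leq_ceil_div (b : nat) : {homo ceil_div^~ b : m n / (m <= n)%N}.
Proof. by move=> m n le_mn; rewrite leq_div2r // leq_add2r. Qed.

Lemma card_ord_itv (a c d : nat) : (d <= a)%N ->
  #|[set m : 'I_a | c <= m < d]%N| = (d - c)%N.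
Proof.
move=> le_da; rewrite -sum1dep_card.
rewrite -(big_mkord (fun m => c <= m < d)%N (fun=> 1%N)).
rewrite (eq_bigl (fun m => (true && (m < d)) && (c <= m))%N); last first.
  by move=> m; rewrite andbC.
by rewrite -big_nat_widenl // -big_nat_widen // sum_nat_const_nat muln1.
Qed.

Lemma f_ab_ceil (a b j : nat) : (0 < b)%N -> (j < b)%N ->
  f_ab a b j = (ceil_div (j.+1 * a) b - ceil_div (j * a) b)%N.
Proof.
move=> b_gt0 lt_jb; rewrite f_ab_nat // -(@card_ord_itv a); last first.
  by rewrite ceil_div_le // mulnC leq_mul2l lt_jb orbT.
apply: eq_card => m; rewrite !inE ceil_div_le //.
by rewrite [(m < _)%N]ltnNge ceil_div_le // -ltnNge.
Qed.

(** Both ends of the [j]-th subinterval, hence also their ceilings, move by an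
integer when [a] is reduced modulo [b]; the two shifts differ by
[a %/ b]. *)
Lemma I_ab_modn (a b j : nat) : (0 < b)%N -> (j < b)%N ->
  I_ab a b j = (f_ab (a %% b) b j)%:Z.
Proof.
move=> b_gt0 lt_jb; rewrite /I_ab !f_ab_ceil //.
rewrite {1 2}(divn_eq a b) !mulnDr !mulnA !ceil_divMDl //.
have le_ceil : (ceil_div (j * (a %% b)) b <= ceil_div (j.+1 * (a %% b)) b)%N.
  by rewrite leq_ceil_div // leq_mul2r leqnSn orbT.
by rewrite mulSn -addnA addnCA subnDl -addnBA // PoszD addrC addKr.
Qed.

(** For [k < l], the condition [j * l <= k * b < j.+1 * l] defining the [j]-th
subinterval says that [j] is the quotient of [k * b] by [l]. *)
Lemma f_ab_divn (l b j : nat) : (0 < b)%N ->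
  f_ab l b j = (\sum_(k < l) ((k * b) %/ l == j))%N.
Proof.
move=> b_gt0; rewrite f_ab_nat // -sum1dep_card big_mkcond /=.
apply: eq_bigr => k _; have l_gt0 : (0 < l)%N by apply: leq_trans (ltn_ord k).
by rewrite -leq_divRL // -ltn_divLR // ltnS -eqn_leq eq_sym; case: eqP.
Qed.

(** Each [k < a %% b] belongs to the single subinterval of index
[(k * b) %/ (a %% b)], so exchanging the two sums leaves one square per [k]. *)
Lemma D2_modn (a b : nat) : (0 < b)%N ->
  D2 a b = \sum_(k < a %% b) ((k * b) %/ (a %% b))%N%:Z ^+ 2.
Proof.
move=> b_gt0; set l := (a %% b)%N.
(* The index j = 0 contributes 0, so it can be included in the sum. *)
have -> : D2 a b = \sum_(j < b) j%:Z ^+ 2 * I_ab a b j.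
  by rewrite -(big_mkord xpredT (fun j => j%:Z ^+ 2 * I_ab a b j))
             big_ltn // expr0n mul0r add0r.
under eq_bigr => j _.
  rewrite I_ab_modn // -/l f_ab_divn // -[X in _ * X]natz natr_sum mulr_sumr.
  over.
rewrite exchange_big /=; apply: eq_bigr => k _.
have lt_b : ((k * b) %/ l < b)%N.
  have l_gt0 : (0 < l)%N by apply: leq_trans (ltn_ord k).
  by rewrite ltn_divLR // mulnC ltn_pmul2l.
rewrite (bigD1 (Ordinal lt_b)) //= eqxx mulr1 big1 ?addr0 // => j neq_j.
by rewrite eq_sym (negPf (_ : (j : nat) != _)) ?mulr0.
Qed.

Lemma D2_divn (a b l : nat) : (l < b)%N -> (a = l %[mod b])%N ->
  D2 a b =
    \sum_(k < l) (k%:Z * (b %/ l)%N%:Z + ((k * (b %% l)) %/ l)%N%:Z) ^+ 2.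
Proof.
move=> lt_lb; rewrite (modn_small lt_lb) => a_mod.
rewrite D2_modn ?a_mod ?(leq_ltn_trans _ lt_lb) //; apply: eq_bigr => k _.
have l_gt0 : (0 < l)%N by apply: leq_trans (ltn_ord k).
by rewrite {1}(divn_eq b l) mulnDr mulnA divnMDl // PoszD PoszM.
Qed.

Ltac compute_quotients :=
  repeat match goal with |- context [((?k * ?r) %/ ?l)%N] =>
    let v := eval compute in ((k * r) %/ l)%N in
    change ((k * r) %/ l)%N with v
  end.

Theorem theorem1 (a b l : nat) (ha : (0 < a)%N) (hb : (0 < b)%N)
    (hl : (l < b)%N) (hal : (a = l %[mod b])%N) :
  (l = 0%N \/ l = 1%N -> D2 a b = 0)
  /\ (l = 2%N -> D2 a b = (b %/ 2)%N%:Z ^+ 2)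
  /\ (l = 3%N ->
        ((b = 0 %[mod 3])%N \/ (b = 1 %[mod 3])%N ->
           D2 a b = 5 * (b %/ 3)%N%:Z ^+ 2)
     /\ ((b = 2 %[mod 3])%N ->
           D2 a b = 5 * (b %/ 3)%N%:Z ^+ 2 + 4 * (b %/ 3)%N%:Z + 1))
  /\ (l = 4%N ->
        ((b = 0 %[mod 4])%N \/ (b = 1 %[mod 4])%N ->
           D2 a b = 14 * (b %/ 4)%N%:Z ^+ 2)
     /\ ((b = 2 %[mod 4])%N ->
           D2 a b = 14 * (b %/ 4)%N%:Z ^+ 2 + 10 * (b %/ 4)%N%:Z + 2)
     /\ ((b = 3 %[mod 4])%N ->
           D2 a b = 14 * (b %/ 4)%N%:Z ^+ 2 + 16 * (b %/ 4)%N%:Z + 5))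
  /\ (l = 5%N ->
        ((b = 0 %[mod 5])%N \/ (b = 1 %[mod 5])%N ->
           D2 a b = 30 * (b %/ 5)%N%:Z ^+ 2)
     /\ ((b = 2 %[mod 5])%N ->
           D2 a b = 30 * (b %/ 5)%N%:Z ^+ 2 + 14 * (b %/ 5)%N%:Z + 2)
     /\ ((b = 3 %[mod 5])%N ->
           D2 a b = 30 * (b %/ 5)%N%:Z ^+ 2 + 26 * (b %/ 5)%N%:Z + 6)
     /\ ((b = 4 %[mod 5])%N ->
           D2 a b = 30 * (b %/ 5)%N%:Z ^+ 2 + 40 * (b %/ 5)%N%:Z + 14)).
Proof.
have D2E := @D2_divn a b l hl hal.
split; [by case=> l_eq; rewrite D2E l_eq ?big_ord_recr big_ord0 /= ?mul0r|].
split; last split; last split.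
all: move=> l_eq; rewrite D2E l_eq !big_ord_recr big_ord0 /=.
(* For l = 2 the two residues of b give the same polynomial. *)
- have: (b %% 2 < 2)%N by rewrite ltn_mod.
  by case: (b %% 2)%N => [|[|//]] _; compute_quotients; ring.
all: repeat split.
all: try case.
all: move=> b_mod; rewrite b_mod /=.
all: compute_quotients; ring.
Qed.
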